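(* Let $G_1$ be a finite connected oriented graph with distinguished vertices $a_1,b_1$ such that $d_1(a_1,b_1)>1$ and there exist at least two edge-disjoint paths connecting $a_1$ to $b_1$ in $G_1$. Let $f_k$ be the crossing probability functions of the hierarchical graphs with seed $G_1$, let $p_\star$ be the unique fixed point of $f_1$ in $(0,1)$ and $\zeta=f_1'(p_\star)>1$. Then: (a) (Existence of correlation length and surface tension) The function $\xi:(0,p_\star)\to(0,\infty)$ given by $$\xi(p)=-\lim_{k\to\infty}\frac{\log f_k(p)}{d_1(a_1,b_1)^k}$$ is well defined and non-decreasing. The non-increasing function $\eta:(p_\star,1)\to(0,\infty)$, $$\eta(p)=-\lim_{k\to\infty}\frac{\log\big(1-f_k(p)\big)}{\mathrm{Cut}(G_1)^k},$$ is well defined. (b) (Critical exponents for the correlation length and surface tension) There exist constants $c_1,c_2>0$ such that $$c_1(p_\star-p)^{-\nu}\le \xi(p)\le c_2(p_\star-p)^{-\nu}\quad\text{for }p\in(p_\star/2,p_\star),$$ where $\nu=\log_\zeta d_1(a_1,b_1)$. Moreover, there exist constants $c_3,c_4>0$ such that $$c_3(p-p_\star)^{-\mu}\le \eta(p)\le c_4(p-p_\star)^{-\mu}\quad\text{for }p\in\big(p_\star,1-(1-p_\star)/2\big),$$ with $\mu=\log_\zeta \mathrm{Cut}(G_1)$.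
   Context: $G_1=(V_1,\mathcal E_1)$ is a finite connected oriented graph with two distinguished vertices $a_1,b_1$. Orientations are used only to define the replacement operation below; distances, paths, cuts and connectivity ignore orientation. $d_1$ is the graph distance in $G_1$. $\mathrm{Cut}(G_1)$ is the size of the minimum edge cut-set between $a_1$ and $b_1$ in $G_1$, i.e. the minimum number of edges of $G_1$ whose removal disconnects $a_1$ from $b_1$. Hierarchical graphs: $G_0$ is a single oriented edge $(a_0,b_0)$. Given $G_k=(V_k,\mathcal E_k)$ with distinguished vertices $a_k,b_k$, the graph $G_{k+1}$ is obtained by replacing each oriented edge $(x,y)\in\mathcal E_k$ by a copy of $G_1$, with $a_1$ placed on $x$ and $b_1$ on $y$; $a_{k+1},b_{k+1}$ are the vertices that were $a_k,b_k$. Percolation: under $\mathbb P^k_p$ each edge of $G_k$ is independently open with probability $p$ and closed with probability $1-p$. $f_k(p)=\mathbb P^k_p(a_k\leftrightarrow b_k)$ is the probability that $a_k$ and $b_k$ are joined by an open path in $G_k$. Under the stated hypothesis on $G_1$, $f_1$ has exactly one fixed point $p_\star$ in $(0,1)$ and $f_1'(p_\star)>1$.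
   Formalization: ξ(p) and η(p) are taken as the reciprocals of the printed limits −lim log f_k(p)/d_1(a_1,b_1)^k and −lim log(1−f_k(p))/Cut(G_1)^k, since the printed limits have the opposite monotonicity and stay bounded near p⋆. *)

(* Defs.v *)
From mathcomp Require Import all_boot all_order all_algebra.
From mathcomp Require Import all_classical all_reals all_analysis.
Set Implicit Arguments.
Unset Strict Implicit.
Unset Printing Implicit Defensive.
Import Order.TTheory GRing.Theory Num.Theory.
Import numFieldNormedType.Exports.
Local Open Scope ring_scope.

(* Finite oriented graphs with two distinguished vertices.  Edges form a type
   of their own, so parallel edges are allowed. *)
Record ograph := OGraph {
  vertex : finType;
  edge : finType;
  src : edge -> vertex;
  tgt : edge -> vertex;
  lend : vertex;
  rend : vertex }.

(* From here on orientation is ignored, except in [replace]. *)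
Definition joins (G : ograph) (e : edge G) (x y : vertex G) : bool :=
  ((src e == x) && (tgt e == y)) || ((src e == y) && (tgt e == x)).

Definition adj (G : ograph) (S : {set edge G}) : rel (vertex G) :=
  fun x y => [exists e in S, joins e x y].

Definition linked (G : ograph) (S : {set edge G}) : rel (vertex G) :=
  connect (adj S).

Definition graph_connected (G : ograph) : Prop :=
  forall x y : vertex G, linked [set: edge G] x y.

Fixpoint edge_path (G : ograph) (x : vertex G) (s : seq (edge G))
    (y : vertex G) : bool :=
  if s is e :: s' then [exists z, joins e x z && edge_path z s' y] else x == y.

(* The least n for which there is a path of length n.  A shortest path visits
   at most #|vertex G| vertices, so only n < #|vertex G| is searched; #|vertex G|
   is the value when there is no path. *)
Definition gdist (G : ograph) (x y : vertex G) : nat :=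
  find (fun n => [exists s : n.-tuple (edge G), edge_path x s y])
       (iota 0 #|vertex G|).

Definition is_cutset (G : ograph) : pred {set edge G} :=
  fun S => ~~ linked (~: S) (lend G) (rend G).

(* Meaningful when lend G != rend G: the whole edge set is then a cut-set. *)
Definition mincut (G : ograph) : nat :=
  #|[arg min_(S < [set: edge G] | is_cutset S) #|S|]|.

Definition two_edge_disjoint_paths (G : ograph) : Prop :=
  exists s1 s2 : seq (edge G),
    [/\ edge_path (lend G) s1 (rend G), edge_path (lend G) s2 (rend G)
      & [disjoint s1 & s2]].

Definition single_edge : ograph :=
  @OGraph bool unit (fun=> false) (fun=> true) false true.

Definition inner (H : ograph) : finType :=
  {v : vertex H | (v != lend H) && (v != rend H)}.

(* The position of the vertex v of the copy of H that replaces the edge e. *)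
Definition place (G H : ograph) (e : edge G) (v : vertex H) :
    vertex G + edge G * inner H :=
  if insub v is Some u then inr (e, u)
  else inl (if v == lend H then src e else tgt e).

Definition replace (G H : ograph) : ograph :=
  @OGraph (vertex G + edge G * inner H)%type (edge G * edge H)%type
    (fun ee => place ee.1 (src ee.2)) (fun ee => place ee.1 (tgt ee.2))
    (inl (lend G)) (inl (rend G)).

Fixpoint hier (G1 : ograph) (k : nat) : ograph :=
  if k is k'.+1 then replace (hier G1 k') G1 else single_edge.

(* A configuration is identified with its set w of open edges. *)
Definition percolation_prob (R : realType) (G : ograph) (p : R)
    (A : {set {set edge G}}) : R :=
  \sum_(w in A) \prod_(e : edge G) (if e \in w then p else 1 - p).

Definition crossing (G : ograph) : {set {set edge G}} :=
  [set w | linked w (lend G) (rend G)].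

Definition crossing_prob (R : realType) (G1 : ograph) (k : nat) (p : R) : R :=
  percolation_prob p (crossing (hier G1 k)).

Definition xi_seq (R : realType) (G1 : ograph) (p : R) : R^nat :=
  fun k => ln (crossing_prob G1 k p) / (gdist (lend G1) (rend G1))%:R ^+ k.

Definition eta_seq (R : realType) (G1 : ograph) (p : R) : R^nat :=
  fun k => ln (1 - crossing_prob G1 k p) / (mincut G1)%:R ^+ k.

(* The limits of - xi_seq and - eta_seq are rates, which vanish at
   criticality; xi and eta are their reciprocals, which diverge there.  Without
   the reciprocal, xi would be non-increasing and eta non-decreasing in p, and
   neither could be of the order of a negative power of the distance to the
   critical point. *)
Definition xi (R : realType) (G1 : ograph) (p : R) : R :=
  (- limn (xi_seq G1 p))^-1.

Definition eta (R : realType) (G1 : ograph) (p : R) : R :=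
  (- limn (eta_seq G1 p))^-1.

Definition crossing_fixpoint (R : realType) (G1 : ograph) (p : R) : Prop :=
  0 < p < 1 /\ crossing_prob G1 1 p = p.

(* Main.v *)
Require Import Defs.
From mathcomp Require Import all_boot all_order all_algebra.
From mathcomp Require Import all_classical all_reals all_analysis.
From mathcomp Require Import ring lra zify.
From mathcomp Require Import fintype finset.
Import Order.TTheory GRing.Theory Num.Theory.
Import numFieldNormedType.Exports.
Set Implicit Arguments.
Unset Strict Implicit.
Unset Printing Implicit Defensive.
Local Open Scope ring_scope.

(** The crossing probability of a hierarchical graph is an iterate: opening the
    edges of the graph of level k + 1 with probability p amounts to opening
    each edge of the graph of level k with probability f(p), where f is the
    crossing polynomial of the seed, because an edge acts as open when its copy
    of the seed is crossed ([linked_replace], [event_weight_open_slices]).  The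
    theorem is thus about the iterates of f on [0, 1].

    The shape of f comes from the Moore-Shannon inequality
    p(1-p)f'(p) > f(p)(1-f(p)), proved by conditioning on one edge at a time
    ([moore_shannon_strict]); it is strict because a minimal cut has at least
    two edges.  It says that the odds ratio of f(p) against p is strictly
    increasing, so f has one fixed point pstar in (0, 1), f lies below the
    diagonal before it and above it afterwards, and f'(pstar) > 1
    ([sshaped_fixpoint]).

    Near 0, p^D <= f(p) <= M p^D with D the distance between the ends: a
    geodesic of open edges suffices to cross, and every crossing uses at least
    D edges.  Hence - ln f_k(p) / D^k decreases with k, by at most ln M / D^(k+1)
    at each step.  It converges to a rate, which is positive because f_k(p)
    falls below 1 / M at some k, and the inverse xi of this rate satisfies
    xi(f(p)) = xi(p) / D ([corrlen_renorm]).  Each step multiplies the distance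
    to pstar by about zeta = f'(pstar) and divides xi by D, and this is the
    power law with exponent nu = ln D / ln zeta ([corrlen_power_law]).  The
    quadratic correction to linearity is absorbed by comparing the functions
    d + c d^2 and d - c d^2 of the distance d, which grow along an orbit
    respectively at least and at most by the factor zeta per step.

    The surface tension is the same statement for the dual polynomial
    g(q) = 1 - f(1 - q), the probability that the closed edges contain a
    cut-set when edges are closed with probability q: the minimal cut size C
    replaces D, g iterates like f, and g has fixed point 1 - pstar with the
    same derivative. *)

(** * Weights of events under independent edges *)

(** The weights a may be numbers or polynomials, and may depend on the edge:
    partial conditioning amounts to giving some edges the weight 0 or 1. *)
Definition event_weight (S : comNzRingType) (E : finType) (A : {set {set E}})
    (a : E -> S) : S :=
  \sum_(w in A) \prod_e (if e \in w then a e else 1 - a e).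

(** Conditioning on the state of e, that is, affinity in the weight of e. *)
Lemma event_weight_split (S : comNzRingType) (E : finType) (A : {set {set E}})
    (a a1 a0 : E -> S) (e : E) :
  a1 e = 1 -> a0 e = 0 -> (forall e', e' != e -> a1 e' = a e' /\ a0 e' = a e') ->
  event_weight A a = a e * event_weight A a1 + (1 - a e) * event_weight A a0.
Proof.
move=> a1e a0e aE; rewrite /event_weight !mulr_sumr -big_split/=.
apply: eq_bigr => w _; rewrite (bigD1 e)//= [in X in _ = _ * X + _](bigD1 e)//=.
rewrite [in X in _ = _ + _ * X](bigD1 e)//= a1e a0e subrr subr0.
have -> : \prod_(i | i != e) (if i \in w then a1 i else 1 - a1 i) =
          \prod_(i | i != e) (if i \in w then a i else 1 - a i).
  by apply: eq_bigr => i /aE[-> _].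
have -> : \prod_(i | i != e) (if i \in w then a0 i else 1 - a0 i) =
          \prod_(i | i != e) (if i \in w then a i else 1 - a i).
  by apply: eq_bigr => i /aE[_ ->].
by case: ifP => _; rewrite !(mul0r, mul1r, mulr0, addr0, add0r).
Qed.

Section EventWeight.
Variables (S : comNzRingType) (E : finType).
Implicit Types (A : {set {set E}}) (a : E -> S).

Lemma event_weightC A a : event_weight (~: A) a = 1 - event_weight A a.
Proof.
apply/eqP; rewrite eq_sym subr_eq; apply/eqP.
transitivity (\prod_e (a e + (1 - a e))).
  by rewrite big1// => e _; rewrite addrC subrK.
rewrite bigA_distr (bigID [in A])/= addrC; congr (_ + _).
by apply: eq_bigl => w; rewrite inE.
Qed.

(** Here w stands for the set of closed elements, whose closing prevents A. *)
Definition dual_event A : {set {set E}} := [set w | ~: w \notin A].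

Lemma event_weight_dual A a :
  event_weight (dual_event A) (fun e => 1 - a e) = 1 - event_weight A a.
Proof.
rewrite -event_weightC /event_weight (reindex_inj (@setC_inj _))/=.
apply: eq_big => [w|w _]; first by rewrite !inE setCK.
by apply: eq_bigr => e _; rewrite inE; case: (e \in w); rewrite //= subKr.
Qed.

End EventWeight.

Section ProductEvent.
Variables (S : comNzRingType) (E F : finType).

Definition slice (w : {set E * F}) (e : E) : {set F} := [set f | (e, f) \in w].

Definition open_slices (B : {set {set F}}) (w : {set E * F}) : {set E} :=
  [set e | slice w e \in B].

(** Over E * F, the slices above distinct e are independent, so the set of e
    whose slice lies in B is again a set of independently open elements, each
    with probability the weight of B. *)
Lemma event_weight_open_slices (A : {set {set E}}) (B : {set {set F}}) (a : S) :
  event_weight [set w | open_slices B w \in A] (fun=> a) =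
  event_weight A (fun=> event_weight B (fun=> a)).
Proof.
pose mu (s : {set F}) := \prod_f (if f \in s then a else 1 - a).
(* A configuration on E * F is a choice of one slice per element of E. *)
pose glue (g : {ffun E -> {set F}}) := [set x : E * F | x.2 \in g x.1].
have glueK : cancel glue (fun w => [ffun e => slice w e]).
  by move=> g; apply/ffunP => e; rewrite ffunE; apply/setP => f; rewrite !inE.
have cutK : cancel (fun w : {set E * F} => [ffun e => slice w e]) glue.
  by move=> w; apply/setP => -[e f]; rewrite !inE/= ffunE inE.
pose good (g : {ffun E -> {set F}}) := [set e | g e \in B].
transitivity (\sum_(g | good g \in A) \prod_e mu (g e)).
  rewrite /event_weight (reindex glue); last first.
    by exists (fun w => [ffun e => slice w e]) => w _; [exact: glueK|exact: cutK].
  apply: eq_big => [g|g _].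
    rewrite inE; congr (_ \in A); apply/setP => e; rewrite !inE; congr (_ \in B).
    by apply/setP => f; rewrite !inE.
  by rewrite /mu pair_bigA/=; apply: eq_bigr => -[e f] _; rewrite inE.
rewrite /event_weight -/(event_weight B _).
have termE (W : {set E}) :
    \prod_e (if e \in W then event_weight B (fun=> a) else 1 - event_weight B (fun=> a))
    = \sum_(g | good g == W) \prod_e mu (g e).
  transitivity (\prod_e \sum_(s | (s \in B) == (e \in W)) mu s).
    apply: eq_bigr => e _; case: (e \in W).
      by apply: eq_bigl => s; rewrite eqb_id.
    by rewrite -event_weightC; apply: eq_bigl => s; rewrite inE eqbF_neg.
  rewrite (bigA_distr_big_dep (fun e s => (s \in B) == (e \in W))).
  apply: eq_bigl => g; apply/familyP/eqP => [gW|<- e].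
    by apply/setP => e; rewrite inE; apply/eqP/gW.
  by rewrite unfold_in inE.
under [RHS]eq_bigr do rewrite termE.
rewrite (exchange_big_dep (fun g => good g \in A))/=; last by move=> W g WA /eqP->.
apply: eq_bigr => g gA; rewrite (big_pred1 (good g))// => W.
by rewrite /= andbC eq_sym; case: eqP => // ->.
Qed.

End ProductEvent.

Section EventBounds.
Variables (R : realType) (E : finType) (A : {set {set E}}) (p : R).
Hypothesis p01 : 0 <= p <= 1.

(** Asking only that s be open has probability exactly p ^+ #|s|. *)
Lemma event_weight_ge (s : {set E}) : (forall w : {set E}, s \subset w -> w \in A) ->
  p ^+ #|s| <= event_weight A (fun=> p).
Proof.
move=> sA; have [p0 p1] : 0 <= p /\ 0 <= 1 - p by case/andP: p01; rewrite subr_ge0.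
have -> : p ^+ #|s| = \prod_e (p + (if e \in s then 0 else 1 - p)).
  rewrite (bigID [in s])/= [X in _ * X]big1 ?mulr1 => [|e /negPf->]; last first.
    by rewrite addrC subrK.
  by under eq_bigr => e -> do rewrite addr0; rewrite prodr_const.
rewrite bigA_distr (bigID [in A])/= [X in _ + X]big1 ?addr0 => [|w wA]; last first.
  have /subsetPn[e es ew] : ~~ (s \subset w) by apply: contra wA => /sA.
  by rewrite (bigD1 e)//= (negPf ew) es mul0r.
apply: ler_sum => w _; apply: ler_prod => e _; case: ifP => _; rewrite ?p0 ?lexx//.
by case: ifP => _; rewrite ?lexx ?p1.
Qed.

(** Union bound over the at most 2 ^ #|E| configurations, each of which has at
    least n open elements. *)
Lemma event_weight_le n : (forall w : {set E}, w \in A -> (n <= #|w|)%N) ->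
  event_weight A (fun=> p) <= 2 ^+ #|E| * p ^+ n.
Proof.
move=> An; have [p0 p1] : 0 <= p /\ 0 <= 1 - p by case/andP: p01; rewrite subr_ge0.
have ple1 : p <= 1 by case/andP: p01.
apply: (@le_trans _ _ (\sum_(w in A) p ^+ n)).
  apply: ler_sum => w wA; rewrite (bigID [in w])/=.
  apply: (@le_trans _ _ (p ^+ #|w| * 1)).
    apply: ler_pM.
    - by apply: prodr_ge0 => e ->.
    - by apply: prodr_ge0 => e /negPf->.
    - by under eq_bigr => e -> do []; rewrite prodr_const.
    - by apply: prodr_ile1 => e /negPf->; rewrite p1/= gerBl.
  by rewrite mulr1 ler_wiXn2l ?An.
rewrite sumr_const -[X in X <= _]mulr_natl -natrX; apply: ler_wpM2r; first exact: exprn_ge0.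
rewrite ler_nat -cardsT -card_powerset subset_leq_card//.
by apply/subsetP => w _; rewrite powersetE subsetT.
Qed.

End EventBounds.

(** * The Moore-Shannon inequality *)
Section MonotoneEvent.
Variables (R : realType) (E : finType) (A : {set {set E}}).
Hypothesis A_up : forall w w' : {set E}, w \subset w' -> w \in A -> w' \in A.

Definition event_poly : {poly R} := event_weight A (fun=> 'X).

(** The probability of A, as a polynomial in p, when the elements of r are
    still random and the others are frozen to the configuration w.  Exposing
    the elements of r one by one gives an induction from the indicator of A to
    the probability of A. *)
Definition cond_poly (r : seq E) (w : {set E}) : {poly R} :=
  event_weight A (fun e => if e \in r then 'X else (e \in w)%:R).

Lemma cond_poly_enum w : cond_poly (enum E) w = event_poly.
Proof.
by apply: eq_bigr => w' _; apply: eq_bigr => e _; rewrite mem_enum.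
Qed.

Lemma cond_poly_nil w : cond_poly [::] w = (w \in A)%:R.
Proof.
have weight (w' : {set E}) : \prod_e (if e \in w' then (e \in w)%:R else 1 - (e \in w)%:R) =
    (w' == w)%:R :> {poly R}.
  have [->|ne] := eqVneq w' w.
    by apply: big1 => e _; case: (e \in w); rewrite ?subr0.
  have [e ne_e] : exists e, (e \in w') != (e \in w).
    apply/existsP; apply: contraR ne => /existsPn same.
    by apply/eqP/setP => e; apply/eqP; have := same e; rewrite negbK.
  rewrite (bigD1 e)//=; case: (e \in w') (e \in w) ne_e => [] []//= _.
    by rewrite mul0r.
  by rewrite subrr mul0r.
rewrite /cond_poly /event_weight; under eq_bigr do rewrite /= weight.
have [wA|wA] := boolP (w \in A); last first.
  by apply: big1 => w' w'A; case: eqP => // ww'; rewrite -ww' w'A in wA.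
by rewrite (bigD1 w)//= eqxx big1 ?addr0// => w' /andP[_ /negPf->].
Qed.

Lemma cond_poly_cons e r w : e \notin r ->
  cond_poly (e :: r) w = 'X * cond_poly r (e |: w) + (1 - 'X) * cond_poly r (w :\ e).
Proof.
move=> er; rewrite /cond_poly.
rewrite (@event_weight_split _ _ _ _ (fun e' => if e' \in r then 'X else (e' \in e |: w)%:R)
  (fun e' => if e' \in r then 'X else (e' \in w :\ e)%:R) e).
- by rewrite inE eqxx.
- by rewrite (negPf er) setU11.
- by rewrite (negPf er) setD11.
by move=> e' /negPf ne; rewrite !inE ne.
Qed.

Variable p : R.
Hypothesis p01 : 0 <= p <= 1.

Notation F r w := ((cond_poly r w).[p]).
Notation F' r w := ((cond_poly r w)^`().[p]).

Lemma cond_horner_cons e r w : e \notin r ->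
  F (e :: r) w = p * F r (e |: w) + (1 - p) * F r (w :\ e).
Proof. by move=> er; rewrite cond_poly_cons// !hornerE. Qed.

Lemma cond_deriv_cons e r w : e \notin r -> F' (e :: r) w =
  F r (e |: w) - F r (w :\ e) + p * F' r (e |: w) + (1 - p) * F' r (w :\ e).
Proof.
move=> er; rewrite cond_poly_cons// derivD !derivM derivB derivX -[1]/(1%:P) derivC.
by rewrite !(hornerD, hornerN, hornerM, hornerX, hornerC); ring.
Qed.

Lemma cond_horner01 r w : uniq r -> 0 <= F r w <= 1.
Proof.
elim: r w => [|e r IH] w /=.
  by rewrite cond_poly_nil -polyC_natr hornerC; case: (_ \in _); rewrite /= ?lexx ?ler01.
move=> /andP[er ur]; rewrite cond_horner_cons//.
have /andP[? ?] := IH (e |: w) ur; have /andP[? ?] := IH (w :\ e) ur.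
by move: p01 => /andP[? ?]; apply/andP; split; nra.
Qed.

Lemma cond_horner_mono r (w w' : {set E}) : uniq r -> w \subset w' -> F r w <= F r w'.
Proof.
elim: r w w' => [|e r IH] w w' /=.
  move=> _ ww'; rewrite !cond_poly_nil -!polyC_natr !hornerC ler_nat.
  by have := A_up ww'; do 2![case: (_ \in _)] => // /(_ isT).
move=> /andP[er ur] ww'; rewrite !cond_horner_cons//.
move: p01 => /andP[? ?]; apply: lerD; apply: ler_wpM2l; rewrite ?subr_ge0//.
  by apply: IH => //; exact: setUS.
by apply: IH => //; exact: setSD.
Qed.

Lemma cond_horner_lb r w : uniq r -> w :|: [set e in r] \in A -> p ^+ size r <= F r w.
Proof.
elim: r w => [|e r IH] w /=.
  rewrite (_ : [set _ in _] = set0) ?setU0 => [_ wA|]; last by apply/setP => x; rewrite !inE.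
  by rewrite cond_poly_nil wA -polyC_natr hornerC.
move=> /andP[er ur] wA; rewrite cond_horner_cons// exprS.
move: p01 => /andP[? ?]; have /andP[? _] := cond_horner01 (w :\ e) ur.
apply: ler_wpDr; first by rewrite mulr_ge0// subr_ge0.
apply: ler_wpM2l => //; apply: IH => //.
by rewrite (_ : _ :|: _ = w :|: [set x in e :: r])//; apply/setP => x; rewrite !inE orbCA orbA.
Qed.

(** Condition on e, and let x and y be the probabilities given that e is open
    or closed.  The induction hypotheses control the two conditional variances,
    and the derivative has the extra term x - y; what is needed of it is
    p(1-p)(x-y)^2 <= p(1-p)(x-y), which holds as 0 <= x - y <= 1. *)
Lemma moore_shannon r w : uniq r ->
  F r w * (1 - F r w) <= p * (1 - p) * F' r w.
Proof.
elim: r w => [|e r IH] w /=.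
  rewrite cond_poly_nil -polyC_natr derivC !hornerC.
  by case: (_ \in _); rewrite /= ?(subrr, mul0r, mulr0).
move=> /andP[er ur]; rewrite cond_horner_cons// cond_deriv_cons//.
have := IH (e |: w) ur; have := IH (w :\ e) ur.
have /andP[] := cond_horner01 (e |: w) ur; have /andP[] := cond_horner01 (w :\ e) ur.
have : F r (w :\ e) <= F r (e |: w).
  by apply: cond_horner_mono => //; apply: (subset_trans (subsetDl _ _)); exact: subsetUr.
move: (F r (e |: w)) (F r (w :\ e)) (F' r (e |: w)) (F' r (w :\ e)) => x y x' y'.
move: p01 => /andP[p0 p1] yx y0 y1 x0 x1 IHy IHx.
have q0 : 0 <= 1 - p by lra.
have IHx' := ler_wpM2l p0 IHx; have IHy' := ler_wpM2l q0 IHy.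
have : 0 <= p * (1 - p) * ((x - y) * (1 - (x - y))).
  by rewrite mulr_ge0 ?mulr_ge0//; lra.
by lra.
Qed.

(** The event survives the closing of any single element: for a crossing event,
    this says that no edge is a cut-set. *)
Hypothesis A_full : [set: E] \in A.
Hypothesis A_cofull : forall e, [set~ e] \in A.

(** The additional term comes from a slack in the previous argument: x - y is
    not only at most 1 but at most 1 - p ^+ size r, because even with e closed
    the event occurs when all of r is open. *)
Lemma moore_shannon_strict r w : uniq r -> w :|: [set e in r] = [set: E] ->
  F r w * (1 - F r w) + p ^+ size r * (1 - F r w) <= p * (1 - p) * F' r w.
Proof.
elim: r w => [|e r IH] w /=.
  rewrite (_ : [set _ in _] = set0) ?setU0 => [_ ->|]; last by apply/setP => x; rewrite !inE.
  by rewrite cond_poly_nil A_full -polyC_natr derivC !hornerC subrr !mulr0 addr0.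
move=> /andP[er ur] wrT; rewrite cond_horner_cons// cond_deriv_cons//.
have wrE (v : {set E}) : (forall x, x != e -> (x \in w) = (x \in v)) ->
    [set~ e] \subset v :|: [set x in r].
  move=> wv; apply/subsetP => x; rewrite !inE => xe.
  by have := in_setT x; rewrite -wrT !inE wv// (negPf xe).
(* This is where the event has to survive the closing of e. *)
have low : p ^+ size r <= F r (w :\ e).
  apply: cond_horner_lb => //; apply: A_up (A_cofull e); apply: wrE => x xe.
  by rewrite !inE xe.
have /(IH _ ur) : e |: w :|: [set x in r] = [set: E].
  apply/eqP; rewrite -subTset; apply/subsetP => x _; have [->|xe] := eqVneq x e.
    by rewrite !inE eqxx.
  by apply: (subsetP (wrE (e |: w) _)); rewrite ?inE// => y /negPf ye; rewrite !inE ye.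
have := moore_shannon (w :\ e) ur.
have /andP[] := cond_horner01 (e |: w) ur; have /andP[] := cond_horner01 (w :\ e) ur.
have : F r (w :\ e) <= F r (e |: w).
  by apply: cond_horner_mono => //; apply: (subset_trans (subsetDl _ _)); exact: subsetUr.
move: low; rewrite exprS.
have pr0 : 0 <= p ^+ size r by rewrite exprn_ge0//; case/andP: p01.
move: (F r (e |: w)) (F r (w :\ e)) (F' r (e |: w)) (F' r (w :\ e)) (p ^+ _) pr0 => x y x' y' m m0.
move: p01 => /andP[p0 p1] my yx y0 y1 x0 x1 IHy IHx.
have q0 : 0 <= 1 - p by lra.
have IHx' := ler_wpM2l p0 IHx; have IHy' := ler_wpM2l q0 IHy.
have : 0 <= p * (1 - p) * ((x - y) * (1 - (x - y) - m)).
  by rewrite mulr_ge0 ?mulr_ge0//; lra.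
by lra.
Qed.

End MonotoneEvent.

Lemma horner_event_poly (R : realType) (E : finType) (A : {set {set E}}) (p : R) :
  (event_poly R A).[p] = event_weight A (fun=> p).
Proof.
rewrite /event_poly /event_weight horner_sum; apply: eq_bigr => w _.
rewrite horner_prod; apply: eq_bigr => e _.
by case: ifP => _; rewrite !(hornerD, hornerN, hornerX, hornerC).
Qed.

(** * Fixed points of S-shaped polynomials *)
Section SShapedMap.
Variables (R : realType) (f : {poly R}).
Hypothesis f01 : forall p : R, 0 < p < 1 -> 0 < f.[p] < 1.
Hypothesis f_sharp : forall p : R, 0 < p < 1 ->
  f.[p] * (1 - f.[p]) < p * (1 - p) * f^`().[p].

Lemma sharp_deriv_gt0 (p : R) : 0 < p < 1 -> 0 < f^`().[p].
Proof.
move=> p_in; have /andP[f0 f1] := f01 p_in; case/andP: (p_in) => p0 p1.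
have pq0 : 0 < p * (1 - p) by rewrite mulr_gt0 ?subr_gt0.
rewrite -(pmulr_rgt0 _ pq0); apply: le_lt_trans (f_sharp p_in).
by rewrite mulr_ge0// ?subr_ge0 ltW.
Qed.

Lemma sharp_homo (x y : R) : 0 <= x -> x <= y -> y <= 1 -> f.[x] <= f.[y].
Proof.
apply: (ger0_derive1_ndecr (f := horner f)).
- by move=> z _; exact: derivable_horner.
- by move=> z z_in; rewrite -derivE ltW// sharp_deriv_gt0.
- exact/continuous_subspaceT/continuous_horner.
Qed.

(** The odds of f(p) divided by the odds of p: it equals 1 exactly at the fixed
    points of f in (0, 1). *)
Let odds_ratio p := f.[p] * (1 - p) / (p * (1 - f.[p])).

(** Up to a positive factor, the derivative of the odds ratio is
    p(1-p)f'(p) - f(p)(1-f(p)). *)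
Lemma odds_ratio_incr (x y : R) : 0 < x -> x < y -> y < 1 -> odds_ratio x < odds_ratio y.
Proof.
move=> x0 xy y1.
pose N := f * (1 - 'X); pose Q := 'X * (1 - f).
have Nh (z : R) : N.[z] = f.[z] * (1 - z).
  by rewrite /N !(hornerD, hornerN, hornerM, hornerX, hornerC).
have Qh (z : R) : Q.[z] = z * (1 - f.[z]).
  by rewrite /Q !(hornerD, hornerN, hornerM, hornerX, hornerC).
have Q0 (z : R) : z \in `]0, 1[ -> 0 < Q.[z].
  move=> z_in; rewrite Qh; have /andP[? ?] := f01 z_in; case/andP: (z_in) => ? ?.
  by rewrite mulr_gt0 ?subr_gt0.
pose g (z : R) := N.[z] * (Q.[z])^-1.
have dg (z : R) : z \in `]0, 1[ -> is_derive z 1 g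
    (N.[z] * (- Q.[z] ^- 2 * Q^`().[z]) + Q.[z]^-1 * N^`().[z]).
  move=> z_in; have Qz : Q.[z] != 0 by rewrite gt_eqF// Q0.
  exact: (is_deriveM (is_derive_poly N z) (is_deriveV Qz (is_derive_poly Q z))).
have gE z : odds_ratio z = g z by rewrite /g Nh Qh.
rewrite !gE.
apply: (gtr0_derive1_lt_oo (f := g) (a := 0) (b := 1)) (xy); rewrite ?in_itv/= ?x0 ?y1 ?andbT//.
- by move=> z /dg[].
- move=> z z_in; case: (dg z z_in) => _ dgE; rewrite derive1E dgE.
  have {}dN : N^`().[z] = f^`().[z] * (1 - z) - f.[z].
    rewrite /N derivM derivB derivX (derivC 1).
    by rewrite !(hornerD, hornerN, hornerM, hornerX, hornerC); ring.
  have {}dQ : Q^`().[z] = 1 - f.[z] - z * f^`().[z].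
    rewrite /Q derivM derivB derivX (derivC 1).
    by rewrite !(hornerD, hornerN, hornerM, hornerX, hornerC); ring.
  have -> : N.[z] * (- Q.[z] ^- 2 * Q^`().[z]) + Q.[z]^-1 * N^`().[z] =
      Q.[z] ^- 2 * (z * (1 - z) * f^`().[z] - f.[z] * (1 - f.[z])).
    have Qz : Q.[z] != 0 by rewrite gt_eqF// Q0.
    rewrite dN dQ Nh; transitivity (Q.[z] ^- 2 * (Q.[z] * (f^`().[z] * (1 - z) - f.[z])
       - f.[z] * (1 - z) * (1 - f.[z] - z * f^`().[z]))); first by field.
    by congr (_ * _); rewrite Qh; ring.
  by rewrite mulr_gt0 ?invr_gt0 ?exprn_gt0 ?Q0// subr_gt0 f_sharp.
- move=> z /set_mem/dg[/derivable1_diffP/differentiable_continuous cg _]; exact: cg.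
- exact: lt_trans xy y1.
- exact: lt_trans x0 xy.
Qed.

Lemma odds_ratio_lt1 (p : R) : 0 < p < 1 -> (odds_ratio p < 1) = (f.[p] < p).
Proof.
move=> p_in; have /andP[? ?] := f01 p_in; case/andP: p_in => ? ?.
rewrite ltr_pdivrMr ?mulr_gt0 ?subr_gt0// mul1r.
by apply/idP/idP => ?; nra.
Qed.

Lemma odds_ratio_gt1 (p : R) : 0 < p < 1 -> (1 < odds_ratio p) = (p < f.[p]).
Proof.
move=> p_in; have /andP[? ?] := f01 p_in; case/andP: p_in => ? ?.
rewrite ltr_pdivlMr ?mulr_gt0 ?subr_gt0// mul1r.
by apply/idP/idP => ?; nra.
Qed.

Lemma sshaped_fixpoint (a b : R) : 0 < a < 1 -> 0 < b < 1 ->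
  f.[a] < a -> b < f.[b] ->
  exists ps : R, [/\ 0 < ps < 1, f.[ps] = ps, 1 < f^`().[ps],
    forall p : R, 0 < p < ps -> f.[p] < p & forall p : R, ps < p < 1 -> p < f.[p]].
Proof.
move=> a_in b_in fa fb; have /andP[a0 a1] := a_in; have /andP[b0 b1] := b_in.
have ra : odds_ratio a < 1 by rewrite odds_ratio_lt1.
have rb : 1 < odds_ratio b by rewrite odds_ratio_gt1.
have ab : a < b.
  rewrite ltNge; apply/negP; rewrite le_eqVlt => /predU1P[ba|ba].
    by move: rb; rewrite ba; lra.
  by have := odds_ratio_incr b0 ba a1; lra.
have [|x /andP[ax xb]] := poly_ivt (p := f - 'X) (ltW ab).
  by rewrite !(hornerD, hornerN, hornerX); apply/andP; split; lra.
rewrite /root hornerD hornerN hornerX subr_eq0 => /eqP fx.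
have [x0 x1] : 0 < x /\ x < 1 by lra.
have rx : odds_ratio x = 1.
  by rewrite /odds_ratio fx divff// gt_eqF// mulr_gt0// subr_gt0.
exists x; split=> //; first by rewrite x0.
- have := f_sharp (p := x); rewrite x0 x1 fx => /(_ isT).
  by rewrite -[X in X < _]mulr1 ltr_pM2l// mulr_gt0// subr_gt0.
- move=> p /andP[p0 px]; have p1 : p < 1 by lra.
  by rewrite -odds_ratio_lt1 ?p0// -rx odds_ratio_incr.
- move=> p /andP[xp p1]; have p0 : 0 < p by lra.
  by rewrite -odds_ratio_gt1 ?p0// -rx odds_ratio_incr.
Qed.

End SShapedMap.

(** * Iteration of a map near a repelling fixed point *)
Lemma horner_bounded (R : realType) (p : {poly R}) :
  exists2 K : R, 0 < K & forall x : R, 0 <= x <= 1 -> `|p.[x]| <= K.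
Proof.
exists (1 + \sum_(i < size p) `|p`_i|) => [|x /andP[x0 x1]].
  by rewrite ltr_wpDr// sumr_ge0.
rewrite horner_coef (le_trans (ler_norm_sum _ _ _))// ler_wpDl// ler_sum// => i _.
by rewrite normrM ler_piMr// normrX exprn_ile1// ger0_norm.
Qed.

Lemma taylor2 (R : realType) (p : {poly R}) (a : R) :
  exists2 K : R, 0 < K & forall x : R, 0 <= x <= 1 ->
    `|p.[x] - p.[a] - p^`().[a] * (x - a)| <= K * (x - a) ^+ 2.
Proof.
pose q := p - p.[a]%:P - p^`().[a]%:P * ('X - a%:P).
have /factor_theorem[q1 q1E] : root q a by rewrite /root !hornerE; apply/eqP; ring.
have dq : q^`().[a] = 0.
  by rewrite /q !derivB derivM derivXsubC !derivC !hornerE; ring.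
have /factor_theorem[q2 q2E] : root q1 a.
  by move: dq; rewrite q1E derivM derivXsubC !hornerE subrr mulr0 add0r /root => ->.
have [K K0 Kq2] := horner_bounded q2; exists K => // x x01.
have -> : p.[x] - p.[a] - p^`().[a] * (x - a) = q2.[x] * (x - a) ^+ 2.
  transitivity q.[x]; first by rewrite /q !hornerE.
  by rewrite q1E q2E !hornerM !hornerXsubC expr2 mulrA.
by rewrite normrM normrX real_normK ?num_real// ler_wpM2r ?sqr_ge0 ?Kq2.
Qed.

(** If one step sends d to d * (z + e) with |e| <= K * d, then the functions
    d + c d^2 and d - c d^2 are respectively a super- and a subsolution of the
    linear recursion with factor z: the quadratic terms gain
    c d^2 ((z + e)^2 - z), and (z + e)^2 - z >= (z - 1)^2 / 4 for d small, which
    is why this c outweighs the error K d^2. *)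
Lemma linearizing_bounds (R : realType) (z K e d : R) :
  1 < z -> 0 < K -> 0 < d -> K * d <= (z - 1) / 2 -> `|e| <= K * d ->
  let c := 4 * K / (z - 1) ^+ 2 in let d' := d * (z + e) in
  z * (d + c * d ^+ 2) <= d' + c * d' ^+ 2 /\
  d' - c * d' ^+ 2 <= z * (d - c * d ^+ 2).
Proof.
move=> z1 K0 d0 Kd; rewrite ler_norml => /andP[e1 e2] c d'.
have z10 : 0 < (z - 1) ^+ 2 by rewrite exprn_gt0// subr_gt0.
have cK : c * (z - 1) ^+ 2 = 4 * K by rewrite /c divfK// gt_eqF.
have c0 : 0 <= c by rewrite divr_ge0 ?ltW// mulr_gt0.
have gap : K * d ^+ 2 <= c * d ^+ 2 * ((z + e) ^+ 2 - z).
  rewrite mulrAC ler_pM2r ?exprn_gt0//.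
  have : c * ((z - 1) ^+ 2 / 4) <= c * ((z + e) ^+ 2 - z) by apply: ler_wpM2l => //; nra.
  by rewrite mulrA cK; lra.
have e1d : - (K * d ^+ 2) <= d * e by rewrite expr2; nra.
have e2d : d * e <= K * d ^+ 2 by rewrite expr2; nra.
have -> : d' + c * d' ^+ 2 = z * (d + c * d ^+ 2) + (d * e + c * d ^+ 2 * ((z + e) ^+ 2 - z)).
  by rewrite /d'; ring.
have -> : d' - c * d' ^+ 2 = z * (d - c * d ^+ 2) + (d * e - c * d ^+ 2 * ((z + e) ^+ 2 - z)).
  by rewrite /d'; ring.
split; lra.
Qed.

(** What the crossing polynomial and its dual have in common.  The bounds say
    that h behaves as the power D near its attracting fixed point 0, whose
    basin ends at the fixed point xs. *)
Record renorm_map (R : realType) (h : {poly R}) (D : nat) (M xs : R) : Prop :=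
  RenormMap {
    renorm_exponent : (1 < D)%N;
    renorm_const : 1 <= M;
    renorm_fixpoint01 : 0 < xs < 1;
    renorm_fixpoint : h.[xs] = xs;
    renorm_ge : forall x : R, 0 <= x <= 1 -> x ^+ D <= h.[x];
    renorm_le : forall x : R, 0 <= x <= 1 -> h.[x] <= M * x ^+ D;
    renorm_homo : forall x y : R, 0 <= x -> x <= y -> y <= 1 -> h.[x] <= h.[y];
    renorm_lt : forall x : R, 0 < x < xs -> h.[x] < x }.

Section RenormalizationMap.
Variables (R : realType) (h : {poly R}) (D : nat) (M xs : R).
Hypothesis h_map : renorm_map h D M xs.
Implicit Types x y : R.

Let D_gt1 := renorm_exponent h_map.
Let M_ge1 := renorm_const h_map.
Let xs_gt0 : 0 < xs. Proof. by case/andP: (renorm_fixpoint01 h_map). Qed.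
Let xs_lt1 : xs < 1. Proof. by case/andP: (renorm_fixpoint01 h_map). Qed.
Let h_xs := renorm_fixpoint h_map.
Let h_lb := renorm_ge h_map.
Let h_ub := renorm_le h_map.
Let h_homo := renorm_homo h_map.
Let h_lt := renorm_lt h_map.

Notation it k x := (iter k (horner h) x).

Definition lograte (x : R) : R^nat := fun k => ln (it k x) / D%:R ^+ k.

(** The inverse rate of decay of the iterates: the correlation length for the
    crossing polynomial, the function eta for its dual. *)
Definition corrlen (x : R) : R := (- limn (lograte x))^-1.

Let D_gt0 : 0 < D%:R :> R. Proof. by rewrite ltr0n ltnW. Qed.
Let Dk_gt0 k : 0 < D%:R ^+ k :> R. Proof. exact: exprn_gt0. Qed.

Let basin_unit x : 0 < x < xs -> 0 <= x <= 1.
Proof. by move: xs_lt1 => ? ?; lra. Qed.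

Lemma basin_stable x : 0 < x < xs -> 0 < h.[x] < xs.
Proof.
move=> x_in; have x01 := basin_unit x_in; case/andP: x_in => x0 xlt.
have -> : h.[x] < xs by apply: lt_trans (xlt); apply: h_lt; rewrite x0.
by rewrite andbT (lt_le_trans _ (h_lb x01))// exprn_gt0.
Qed.

Lemma iter_basin k x : 0 < x < xs -> 0 < it k x < xs.
Proof. by move=> x_in; elim: k => //= k IH; exact: basin_stable. Qed.

Lemma iter_homo k x y : 0 < x -> x <= y -> y < xs -> it k x <= it k y.
Proof.
move=> x0 xy yxs; elim: k => //= k IH.
have /andP[? _] : 0 < it k x < xs by apply: iter_basin; rewrite x0 (le_lt_trans xy).
have /andP[_ ?] : 0 < it k y < xs by apply: iter_basin; rewrite yxs (lt_le_trans x0).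
by move: xs_lt1 => ?; apply: h_homo => //; lra.
Qed.

(** The orbit decreases to a fixed point below xs, which can only be 0. *)
Lemma iter_small x e : 0 < x < xs -> 0 < e -> exists k, it k x < e.
Proof.
move=> x_in e0; apply: contrapT => no_k.
have e_le k : e <= it k x by rewrite leNgt; apply/negP => ?; apply: no_k; exists k.
have noninc : nonincreasing_seq (fun k => it k x).
  by apply/nonincreasing_seqP => k /=; rewrite ltW// h_lt// iter_basin.
have cvg_it : cvgn (fun k => it k x).
  by apply: nonincreasing_is_cvgn => //; exists e => _ [k _ <-].
set l := limn (fun k => it k x) in cvg_it.
have el : e <= l by apply: limr_ge => //; near=> k.
have lx : l <= x by apply: limr_le => //; near=> k; exact: (noninc 0%N k).
have hl : h.[l] = l.
  have cvgS : (it k.+1 x @[k --> \oo] --> l)%classic by rewrite (cvg_shiftS (fun k => it k x)).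
  have cvgh : (h.[it k x] @[k --> \oo] --> h.[l])%classic.
    by apply: (@cvg_comp _ _ _ (fun k => it k x) (horner h) _ _ _ cvg_it); exact: continuous_horner.
  exact: (cvg_unique _ cvgh cvgS).
have : h.[l] < l by apply: h_lt; case/andP: x_in => ? ?; apply/andP; split; lra.
by rewrite hl ltxx.
Unshelve. all: by end_near. Qed.

(** The lower bound x ^+ D <= h(x) reads D * ln x <= ln (h x). *)
Lemma lograte_nondecreasing x : 0 < x < xs -> nondecreasing_seq (lograte x).
Proof.
move=> x_in; apply/nondecreasing_seqP => k; rewrite /lograte /=.
have /andP[y0 yxs] := iter_basin k x_in.
have /andP[hy0 _] := basin_stable (iter_basin k x_in).
rewrite ler_pdivlMr// exprSr mulrA divfK ?gt_eqF// mulr_natr -lnXn//.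
by rewrite ler_ln ?posrE ?exprn_gt0// h_lb// basin_unit// y0.
Qed.

Lemma lograte_le0 x k : 0 < x < xs -> lograte x k <= 0.
Proof.
move=> x_in; have /andP[y0 yxs] := iter_basin k x_in.
by rewrite /lograte pmulr_lle0 ?invr_gt0// ln_le0//; move: xs_lt1; lra.
Qed.

Lemma lograte_cvg x : 0 < x < xs -> cvgn (lograte x).
Proof.
move=> x_in; apply: nondecreasing_is_cvgn; first exact: lograte_nondecreasing.
by exists 0 => _ [k _ <-]; exact: lograte_le0.
Qed.

(** The upper bound h(x) <= M x^D makes lograte x j + ln M / D^j nonincreasing
    in j; as 2 <= D, the corrections ln M / D^j decay fast enough to absorb the
    errors. *)
Lemma lograte_upper x k n : 0 < x < xs -> (k <= n)%N ->
  lograte x n <= (ln (it k x) + ln M) / D%:R ^+ k.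
Proof.
move=> x_in; have M0 : 0 < M by move: M_ge1; lra.
pose t j := lograte x j + ln M / D%:R ^+ j.
have lnM0 : 0 <= ln M by exact: ln_ge0.
have t_noninc : nonincreasing_seq t.
  apply/nonincreasing_seqP => j; rewrite /t /lograte -!mulrDl ler_pdivrMr// exprSr.
  have /andP[y0 yxs] := iter_basin j x_in.
  have /andP[hy0 _] := basin_stable (iter_basin j x_in).
  rewrite mulrA divfK ?gt_eqF//=.
  have : ln h.[it j x] <= ln M + ln (it j x) *+ D.
    rewrite -lnXn// -lnM ?posrE ?exprn_gt0//.
    by rewrite ler_ln ?posrE ?mulr_gt0 ?exprn_gt0// h_ub// basin_unit// y0.
  rewrite -mulr_natr mulrDl.
  have : ln M *+ 2 <= ln M * D%:R.
    by rewrite -[X in X <= _]mulr_natr; apply: ler_wpM2l => //; rewrite ler_nat.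
  by rewrite mulr2n; lra.
move=> kn; apply: (@le_trans _ _ (t n)).
  by rewrite /t lerDl divr_ge0// ltW.
by apply: le_trans (t_noninc _ _ kn) _; rewrite /t /lograte mulrDl.
Qed.

Lemma lograte_lim_lt0 x : 0 < x < xs -> limn (lograte x) < 0.
Proof.
move=> x_in; have M0 : 0 < M by move: M_ge1; lra.
have [|k small] := iter_small x_in (e := M^-1); first by rewrite invr_gt0.
have /andP[y0 yxs] := iter_basin k x_in.
apply: (@le_lt_trans _ _ ((ln (it k x) + ln M) / D%:R ^+ k)).
  apply: limr_le; first exact: lograte_cvg.
  by exists k => // n /= kn; exact: lograte_upper.
rewrite pmulr_llt0 ?invr_gt0//.
have : ln (it k x) < ln M^-1 by rewrite ltr_ln ?posrE ?invr_gt0.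
by rewrite lnV ?posrE//; lra.
Qed.

Lemma corrlen_gt0 x : 0 < x < xs -> 0 < corrlen x.
Proof. by move=> x_in; rewrite invr_gt0 oppr_gt0 lograte_lim_lt0. Qed.

Lemma corrlen_homo x y : 0 < x -> x <= y -> y < xs -> corrlen x <= corrlen y.
Proof.
move=> x0 xy yxs.
have x_in : 0 < x < xs by rewrite x0 (le_lt_trans xy).
have y_in : 0 < y < xs by rewrite yxs (lt_le_trans x0).
rewrite lef_pV2 ?posrE ?oppr_gt0 ?lograte_lim_lt0// lerN2.
apply: ler_lim; [exact: lograte_cvg|exact: lograte_cvg|].
near=> k; rewrite /lograte ler_pM2r ?invr_gt0//.
have /andP[? _] := iter_basin k x_in; have /andP[? _] := iter_basin k y_in.
by rewrite ler_ln ?posrE// iter_homo.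
Unshelve. all: by end_near. Qed.

(** Starting from h(x) shifts the orbit by one step. *)
Lemma corrlen_renorm x : 0 < x < xs -> corrlen h.[x] = corrlen x / D%:R.
Proof.
move=> x_in; rewrite /corrlen.
suff -> : limn (lograte h.[x]) = limn (lograte x) * D%:R by rewrite -mulNr invfM.
apply: cvg_lim => //.
have shift k : lograte h.[x] k = lograte x k.+1 * D%:R.
  rewrite /lograte -iterSr exprS invfM; field.
  by rewrite !gt_eqF.
rewrite (_ : lograte _ = (fun k => lograte x k.+1 * D%:R)); last exact/funext.
apply: cvgMr_tmp; rewrite (cvg_shiftS (lograte x)).
exact: lograte_cvg.
Qed.

Notation z := (h^`().[xs]).
Notation nu := (ln D%:R / ln z).

(** Second-order expansion of the map at its fixed point, in terms of the
    distance d to it: d' := xs - h(xs - d) equals d * (z + e) with e = O(d).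
    The window L is small enough for one step to be controlled by
    [linearizing_bounds], and one step started below L / (2 * z) stays below
    L. *)
Lemma linearizing_window : 1 < z -> exists c L : R,
  [/\ 0 < c, 0 < L <= xs / 2, c * L <= 1 / 2 &
   forall d, 0 < d -> d < L / (2 * z) -> let d' := xs - h.[xs - d] in
    [/\ 0 < d' < L, z * (d + c * d ^+ 2) <= d' + c * d' ^+ 2 &
        d' - c * d' ^+ 2 <= z * (d - c * d ^+ 2)]].
Proof.
move=> z1; have [xs0 xs1] : 0 < xs /\ xs < 1 by [].
have [K K0 taylor] := taylor2 h xs.
have [c c0 cE] : exists2 c, 0 < c & c = 4 * K / (z - 1) ^+ 2.
  by eexists; last reflexivity; rewrite divr_gt0 ?exprn_gt0 ?subr_gt0// mulr_gt0.
have [L [L0 Lxs LK Lc]] : exists L : R,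
    [/\ 0 < L, L <= xs / 2, K * L <= (z - 1) / 2 & c * L <= 1 / 2].
  exists (Num.min (xs / 2) (Num.min ((z - 1) / 2 / K) (1 / 2 / c))).
  rewrite !lt_min !divr_gt0 ?subr_gt0//; split => //; first by rewrite ge_min lexx.
    by rewrite mulrC -ler_pdivlMr// ge_min ge_min lexx orbT.
  by rewrite mulrC -ler_pdivlMr// ge_min ge_min lexx !orbT.
exists c, L; split => //; first by rewrite L0.
move=> d d0; rewrite ltr_pdivlMr ?mulr_gt0//; last by lra.
move=> dzL d'; have dL : d < L by nra.
have x_in : 0 < xs - d < xs by lra.
pose e := d' / d - z.
have d'E : d' = d * (z + e) by rewrite /e addrC subrK mulrC divfK// gt_eqF.
have Kd : K * d <= (z - 1) / 2 by apply: le_trans LK; rewrite ler_pM2l//; lra.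
have eK : `|e| <= K * d.
  have := taylor _ (basin_unit x_in); rewrite h_xs.
  rewrite (_ : _ - _ - _ = - (d * e)); last first.
    by transitivity (- d' + z * d); [rewrite /d'; ring|rewrite d'E; ring].
  rewrite (_ : K * _ = d * (K * d)); last by ring.
  by rewrite normrN normrM gtr0_norm// ler_pM2l.
have [le_up le_low] := linearizing_bounds z1 K0 d0 Kd eK.
rewrite -d'E -cE in le_up le_low; split => //.
have /andP[_ ?] := basin_stable x_in.
apply/andP; split; first by rewrite /d'; lra.
by move: eK; rewrite ler_norml => /andP[_ ?]; rewrite d'E; nra.
Qed.

(** Since z to the power nu is D, the product of [corrlen] at distance d by
    (d + c * d ^+ 2) to the power nu can only grow along an orbit, by
    [corrlen_renorm] and [linearizing_window]; with (d - c * d ^+ 2) it can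
    only decrease.  Hence both are controlled by their values when the orbit
    leaves the window [0, eps], where the monotone function [corrlen] is
    bounded above and below by positive constants. *)
Lemma corrlen_near_fixpoint : 1 < z -> exists L Clow Cup : R,
  [/\ 0 < L < xs, 0 < Clow & forall d, 0 < d < L ->
    Clow <= corrlen (xs - d) * d `^ nu <= Cup].
Proof.
move=> z1; have [xs0 xs1] : 0 < xs /\ xs < 1 by [].
have D0 : 0 < D%:R :> R by [].
have nu0 : 0 < nu by rewrite divr_gt0 ?ln_gt0// ltr1n.
have znu : z `^ nu = D%:R.
  have lnz : ln z != 0 by rewrite gt_eqF// ln_gt0.
  by rewrite /powR gt_eqF ?(lt_trans ltr01)//= divfK// lnK.
move: nu nu0 znu => t t0 zt.
have [c [L [c0 /andP[L0 Lxs] Lc window]]] := linearizing_window z1.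
pose eps := L / (2 * z).
have epsE : 2 * z * eps = L by rewrite /eps mulrC divfK// gt_eqF// mulr_gt0//; lra.
have eps0 : 0 < eps by rewrite divr_gt0// mulr_gt0//; lra.
have epsL : eps < L by nra.
have powM (x y : R) : 0 <= x -> x <= y -> x `^ t <= y `^ t.
  by move=> x0 xy; apply: ge0_ler_powR; rewrite ?nnegrE ?(le_trans x0 xy)// ltW.
have corr_ge0 x : 0 < x < xs -> 0 <= corrlen x by move=> ?; rewrite ltW// corrlen_gt0.
have cdP d : d < L -> c * d <= 1 / 2 by move=> dL; apply: le_trans Lc; rewrite ler_pM2l// ltW.
pose Cup := corrlen (xs - eps) * (2 * L) `^ t.
pose Clow := corrlen (xs - L) * (eps / 2) `^ t.
have escaped d : eps <= d -> d < L ->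
    corrlen (xs - d) * (d + c * d ^+ 2) `^ t <= Cup /\
    Clow <= corrlen (xs - d) * (d - c * d ^+ 2) `^ t.
  move=> epsd dL; have cd := cdP _ dL; have d0 : 0 < d by lra.
  split; apply: ler_pM; rewrite ?powR_ge0//.
  - by apply: corr_ge0; lra.
  - by apply: corrlen_homo; lra.
  - by apply: powM; rewrite expr2; nra.
  - by apply: corr_ge0; lra.
  - by apply: corrlen_homo; lra.
  - by apply: powM; rewrite ?expr2; nra.
have bounds d : 0 < d -> d < L ->
    corrlen (xs - d) * (d + c * d ^+ 2) `^ t <= Cup /\
    Clow <= corrlen (xs - d) * (d - c * d ^+ 2) `^ t.
  move=> d0 dL; have [k] : exists k, it k (xs - d) < xs - eps by apply: iter_small; lra.
  elim: k d d0 dL => [|k IH] d d0 dL; first by move=> /= ?; apply: escaped => //; lra.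
  have [epsd|deps] := leP eps d; first by move=> _; exact: escaped.
  have [/andP[d'0 d'L] up low] := window d d0 deps.
  have := corrlen_renorm (x := xs - d); rewrite subr_gt0 gtrBl d0 => /(_ ltac:(lra)).
  set d' := xs - h.[xs - d] in d'0 d'L up low *.
  have hE : h.[xs - d] = xs - d' by rewrite subKr.
  rewrite iterSr hE => corrE /IH[]// IHup IHlow.
  have -> : corrlen (xs - d) = corrlen (xs - d') * D%:R by rewrite corrE divfK// gt_eqF.
  have [cd cd'] := (cdP _ dL, cdP _ d'L).
  have corr0 : 0 <= corrlen (xs - d') by apply: corr_ge0; lra.
  rewrite -!mulrA -zt -!powRM; [|lra|rewrite expr2; nra|lra|rewrite expr2; nra].
  split; [apply: le_trans IHup|apply: (le_trans IHlow)]; apply: ler_wpM2l => //.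
    by apply: powM => //; rewrite mulr_ge0//; [lra|rewrite expr2; nra].
  by apply: powM => //; rewrite expr2; nra.
exists L, Clow, Cup; split; first by lra.
  by rewrite mulr_gt0 ?powR_gt0 ?corrlen_gt0 ?divr_gt0//; lra.
move=> d /andP[d0 dL]; have [up low] := bounds d d0 dL; have cd := cdP d dL.
have corr0 : 0 <= corrlen (xs - d) by apply: corr_ge0; lra.
have cd2 : 0 <= c * d ^+ 2 by rewrite mulr_ge0 ?sqr_ge0 ?ltW.
apply/andP; split; [apply: le_trans low _|apply: le_trans up];
  apply: ler_wpM2l => //; apply: powM; rewrite ?gerBl ?lerDl ?(ltW d0)//.
by rewrite expr2; nra.
Qed.

Lemma corrlen_power_law : 1 < z ->
  exists c1 c2 : R, [/\ 0 < c1, 0 < c2 & forall x, xs / 2 < x < xs ->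
    c1 * (xs - x) `^ (- nu) <= corrlen x <= c2 * (xs - x) `^ (- nu)].
Proof.
move=> z1; have [xs0 xs1] : 0 < xs /\ xs < 1 by [].
have nu0 : 0 <= nu by rewrite divr_ge0// ln_ge0 ?ler1n ?ltW// ltnW.
have powM (x y : R) : 0 <= x -> x <= y -> x `^ nu <= y `^ nu.
  by move=> x0 xy; apply: ge0_ler_powR; rewrite ?nnegrE ?(le_trans x0 xy).
have nu_pos (x : R) : 0 < x -> 0 < x `^ nu by exact: powR_gt0.
have [L [Clow [Cup [/andP[L0 Lxs] Clow0 near_xs]]]] := corrlen_near_fixpoint z1.
pose c1 := Num.min Clow (corrlen (xs / 2) * L `^ nu).
pose c2 := Num.max Cup (corrlen (xs - L) * xs `^ nu).
exists c1, c2; split.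
- by rewrite lt_min Clow0 mulr_gt0 ?nu_pos ?corrlen_gt0 ?divr_gt0//; lra.
- by rewrite lt_max; apply/orP; right; rewrite mulr_gt0 ?nu_pos ?corrlen_gt0//; lra.
move=> x /andP[x_lb x_ub]; have d0 : 0 < xs - x by lra.
rewrite powRN ler_pdivrMr ?nu_pos// ler_pdivlMr ?nu_pos// ge_min le_max.
have [dL|Ld] := ltP (xs - x) L.
  by have /andP[] := near_xs (xs - x) ltac:(lra); rewrite subKr => -> ->.
have corr0 : 0 <= corrlen x by rewrite ltW// corrlen_gt0//; lra.
have corr_half : 0 <= corrlen (xs / 2) by rewrite ltW// corrlen_gt0//; lra.
apply/andP; split; apply/orP; right; apply: ler_pM; rewrite ?powR_ge0//.
- by apply: corrlen_homo; lra.
- by apply: powM; lra.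
- by apply: corrlen_homo; lra.
- by apply: powM; lra.
Qed.

End RenormalizationMap.

(** * Paths, distances and cut-sets *)
Section Paths.
Variable G : ograph.
Implicit Types (S : {set edge G}) (x y z : vertex G) (e : edge G) (s : seq (edge G)).

Lemma joinsC e x y : joins e x y = joins e y x.
Proof. by rewrite /joins orbC. Qed.

Lemma adjC S x y : adj S x y = adj S y x.
Proof. by apply: eq_existsb => e; rewrite joinsC. Qed.

Lemma linked_sym S : connect_sym (adj S).
Proof. by apply: sym_connect_sym => x y; exact: adjC. Qed.

Lemma linkedC S x y : linked S x y = linked S y x.
Proof. exact: linked_sym. Qed.

Lemma linked_joins S e x y : e \in S -> joins e x y -> linked S x y.
Proof. by move=> eS exy; apply: connect1; apply/existsP; exists e; rewrite eS. Qed.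

Lemma linked_mono S S' x y : S \subset S' -> linked S x y -> linked S' x y.
Proof.
move=> /subsetP SS'; apply: connect_sub => {}x {}y /exists_inP[e eS exy].
by apply: linked_joins exy; exact: SS'.
Qed.

Lemma linked_invariant S (P : pred (vertex G)) x y :
  (forall e, e \in S -> P (src e) = P (tgt e)) -> linked S x y -> P x = P y.
Proof.
move=> PS; apply: closed_connect => {}x {}y /exists_inP[e eS].
by case/orP => /andP[/eqP<- /eqP<-]; rewrite !unfold_in PS.
Qed.

Lemma edge_path_linked S s x y : {subset s <= S} -> edge_path x s y -> linked S x y.
Proof.
elim: s x => [|e s IH] x sS /=; first by move/eqP->; exact: connect0.
case/existsP => z /andP[exz szy]; apply: (connect_trans (y := z)).
  by apply: linked_joins exz; rewrite sS ?mem_head.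
by apply: IH => // e' e's; rewrite sS// in_cons e's orbT.
Qed.

Lemma edge_path_rcons s e x y z :
  edge_path x s y -> joins e y z -> edge_path x (rcons s e) z.
Proof.
elim: s x => [|e' s IH] x /=.
  by move/eqP-> => eyz; apply/existsP; exists z; rewrite eyz eqxx.
case/existsP => t /andP[ext sty] eyz; apply/existsP; exists t; rewrite ext.
exact: IH.
Qed.

Lemma linked_short_path S x y : linked S x y ->
  exists2 s, edge_path x s y & (size s < #|vertex G|)%N.
Proof.
move=> /connectP[p + ->] => /shortenP[{}p path_p uniq_p _].
have size_p : (size p < #|vertex G|)%N.
  by rewrite -[X in (X <= _)%N]/(size (x :: p)) -(card_uniqP uniq_p) max_card.
suff [s xs size_s] : exists2 s, edge_path x s (last x p) & size s = size p.
  by exists s; rewrite ?size_s.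
elim: p x path_p {uniq_p size_p} => [|z p IH] x /=; first by exists [::] => /=.
case/andP=> /exists_inP[e _ exz] /IH[s zs <-]; exists (e :: s) => //=.
by apply/existsP; exists z; rewrite exz.
Qed.

Lemma gdist_le_card x y : (gdist x y <= #|vertex G|)%N.
Proof. by rewrite -[X in (_ <= X)%N](size_iota 0); exact: find_size. Qed.

Lemma gdist_le s x y : edge_path x s y -> (gdist x y <= size s)%N.
Proof.
move=> xsy; rewrite leqNgt; apply/negP => lt_s.
have s_card := leq_trans lt_s (gdist_le_card x y).
have := before_find 0%N lt_s; rewrite nth_iota// add0n.
by move/existsP; apply; exists (in_tuple s).
Qed.

Lemma gdist_path x y : (gdist x y < #|vertex G|)%N ->
  exists2 s, edge_path x s y & size s = gdist x y.
Proof.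
move=> lt_card; have := lt_card; rewrite -[X in (_ < X)%N](size_iota 0) -has_find.
move=> /(nth_find 0%N); rewrite -/(gdist x y) nth_iota// add0n.
by case/existsP => s xsy; exists s => //; rewrite size_tuple.
Qed.

Lemma linked_gdist_path S x y : linked S x y ->
  exists2 s, edge_path x s y & size s = gdist x y.
Proof.
by move=> /linked_short_path[s /gdist_le le_s lt_s]; apply/gdist_path/(leq_ltn_trans le_s).
Qed.

Lemma gdist_joins x e y z : joins e y z -> (gdist x z <= (gdist x y).+1)%N.
Proof.
move=> eyz; have [/gdist_path[s xsy <-]|le_card] := ltnP (gdist x y) #|vertex G|.
  by rewrite -(size_rcons s e); apply: gdist_le; apply: edge_path_rcons eyz.
by apply: leq_trans (gdist_le_card x z) _; apply: leqW.
Qed.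

(** A set of edges that links x to y has, for each i below the distance, an
    edge from level i to level i + 1 of the distance to x, since otherwise it
    could not leave the ball of radius i.  Edges at distinct levels are
    distinct. *)
Lemma gdist_linked_card S x y : linked S x y -> (gdist x y <= #|S|)%N.
Proof.
move=> xy; pose level e := minn (gdist x (src e)) (gdist x (tgt e)).
have lipschitz e : (gdist x (tgt e) <= (gdist x (src e)).+1)%N /\
    (gdist x (src e) <= (gdist x (tgt e)).+1)%N.
  by split; apply: (@gdist_joins _ e); rewrite /joins !eqxx ?orbT.
have gdist_xx : gdist x x = 0%N by apply/eqP; rewrite -leqn0; apply: (@gdist_le [::]) => /=.
rewrite -[X in (X <= _)%N](size_iota 0) -(size_image level S).
apply: uniq_leq_size (iota_uniq _ _) _ => i; rewrite mem_iota add0n /= => lt_i.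
apply: contraT => no_edge.
have same_side : forall e, e \in S ->
    (gdist x (src e) <= i)%N = (gdist x (tgt e) <= i)%N.
  move=> e eS; have [le1 le2] := lipschitz e.
  have : level e != i by apply: contra no_edge => /eqP <-; apply: image_f.
  by rewrite /level => ?; lia.
have := linked_invariant (P := fun v => (gdist x v <= i)%N) same_side xy.
by rewrite gdist_xx leq0n leqNgt lt_i.
Qed.

End Paths.

Section Cuts.
Variable G : ograph.
Hypothesis lend_neq_rend : lend G != rend G.
Implicit Types S : {set edge G}.

Lemma mincut_spec :
  (exists2 S : {set edge G}, is_cutset S & #|S| = mincut G) /\
  (forall S : {set edge G}, is_cutset S -> (mincut G <= #|S|)%N).
Proof.
have cutT : is_cutset [set: edge G].
  apply: contra lend_neq_rend; rewrite setCT => linked0; apply/eqP.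
  have none (e : edge G) : e \in set0 -> (src e == lend G) = (tgt e == lend G).
    by rewrite inE.
  by have := linked_invariant (P := pred1 (lend G)) none linked0; rewrite /= eqxx => /esym/eqP.
rewrite /mincut; case: arg_minnP => // S cutS minS; split; last exact: minS.
by exists S.
Qed.

(** A cut-set meets both paths, in distinct edges. *)
Lemma mincut_gt1 : two_edge_disjoint_paths G -> (1 < mincut G)%N.
Proof.
case=> s1 [s2 [path1 path2 /pred0P disj]].
have [[S cutS <-] _] := mincut_spec.
have meets s : edge_path (lend G) s (rend G) -> exists2 e, e \in S & e \in s.
  move=> path_s; suff /existsP[e /andP[]] : [exists e, (e \in S) && (e \in s)] by exists e.
  apply: contraR cutS => /existsPn none; apply: edge_path_linked path_s => e es.
  by rewrite inE; apply/negP => eS; have := none e; rewrite eS es.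
have [[e1 e1S e1s] [e2 e2S e2s]] := (meets _ path1, meets _ path2).
have ne : e1 != e2.
  by apply/eqP => e12; have := disj e1; rewrite /= e1s e12 e2s.
rewrite -[2%N]/(true.+1) -ne -cards2 subset_leq_card//.
by apply/subsetP => e; rewrite !inE => /orP[]/eqP->.
Qed.

End Cuts.

(** * Substitution of the seed graph for edges *)
Section Replace.
Variables G H : ograph.
Hypothesis lend_neq_rend : lend H != rend H.

Lemma place_lend (e : edge G) : place e (lend H) = inl (src e).
Proof. by rewrite /place insubF ?eqxx. Qed.

Lemma place_rend (e : edge G) : place e (rend H) = inl (tgt e).
Proof. by rewrite /place insubF ?eqxx ?andbF// eq_sym (negPf lend_neq_rend). Qed.

Lemma linked_place (w : {set edge G * edge H}) (e : edge G) (u v : vertex H) :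
  linked (slice w e) u v ->
  linked (G := replace G H) w (place e u) (place e v).
Proof.
case/connectP => p + ->; elim: p u => [|z p IH] u /=; first by move=> _; exact: connect0.
case/andP => /exists_inP[f fw fuz] /IH; apply: connect_trans.
apply: (@linked_joins (replace G H) w (e, f)); first by move: fw; rewrite inE.
by case/orP: fuz => /andP[/eqP<- /eqP<-]; rewrite /joins /= !eqxx ?orbT.
Qed.

(** An open path between old vertices may enter and leave a copy of H by the
    same end, so rather than decomposing it, one checks that a set of vertices
    is invariant: a vertex of the copy of H at e is reached when it is linked,
    inside that copy, to an end of e which is linked to x in G. *)
Lemma linked_replace (w : {set edge G * edge H}) (x y : vertex G) :
  linked (G := replace G H) w (inl x) (inl y) = linked (open_slices (crossing H) w) x y.
Proof.
set W := open_slices _ w.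
apply/idP/idP => [|/connectP[p + ->]]; last first.
  elim: p x => [|z p IH] x /=; first by move=> _; exact: connect0.
  case/andP => /exists_inP[e]; rewrite !inE => eW exz /IH; apply: connect_trans.
  have := linked_place eW; rewrite place_lend place_rend.
  by case/orP: exz => /andP[/eqP<- /eqP<-]//; rewrite linkedC.
pose reached (v : vertex (replace G H)) := match v with
  | inl v => linked W x v
  | inr (e, u) => linked W x (src e) && linked (slice w e) (lend H) (val u)
               || linked W x (tgt e) && linked (slice w e) (rend H) (val u)
  end.
(* The two old ends of a copy fit the description of its inner vertices: if
     one is linked to the other inside the copy, then e is itself open in W. *)
have reached_place e v : reached (place e v) =
    linked W x (src e) && linked (slice w e) (lend H) v
    || linked W x (tgt e) && linked (slice w e) (rend H) v.
  have crossW : linked (slice w e) (lend H) (rend H) -> linked W x (src e) = linked W x (tgt e).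
    move=> cross; apply: (same_connect_r (@linked_sym _ _)).
    by apply: (@linked_joins _ _ e); rewrite ?inE// /joins !eqxx.
  have [->|v_lend] := eqVneq v (lend H).
    rewrite place_lend /= [linked _ _ (lend H)]connect0 andbT.
    case: (boolP (linked (slice w e) (rend H) (lend H))) => [|_]; last by rewrite andbF orbF.
    by rewrite linkedC => /crossW->; rewrite andbT orbb.
  have [->|v_rend] := eqVneq v (rend H).
    rewrite place_rend /= [linked _ (rend H) _]connect0 andbT.
    case: (boolP (linked (slice w e) (lend H) (rend H))) => [/crossW->|_].
      by rewrite !andbT orbb.
    by rewrite !andbF.
  by rewrite /place insubT/= ?v_lend.
move=> /(@linked_invariant _ _ reached) /=.
rewrite [linked W x x]connect0 => <- // -[e f] efw.
rewrite /= !reached_place.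
have same v : linked (slice w e) v (src f) = linked (slice w e) v (tgt f).
  apply: (same_connect_r (@linked_sym _ _)).
  by apply: (@linked_joins _ _ f); rewrite ?inE// /joins !eqxx.
by rewrite !same.
Qed.

Lemma crossing_replace :
  crossing (replace G H) = [set w | open_slices (crossing H) w \in crossing G].
Proof. by apply/setP => w; rewrite !inE linked_replace. Qed.

End Replace.

(** * The crossing polynomial of the seed graph *)

(** The failure probability, as a function of the probability 1 - p of being
    closed. *)
Definition dual_poly (R : realType) (f : {poly R}) : {poly R} := 1 - (f \Po (1 - 'X)).

Section DualPoly.
Variables (R : realType) (f : {poly R}).

Lemma horner_dual_poly q : (dual_poly f).[q] = 1 - f.[1 - q].
Proof. by rewrite !(hornerD, hornerN, hornerC, hornerX, horner_comp). Qed.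

Lemma deriv_dual_poly q : (dual_poly f)^`().[q] = f^`().[1 - q].
Proof.
rewrite /dual_poly derivB (derivC 1) deriv_comp derivB derivX (derivC 1).
by rewrite !(hornerD, hornerN, hornerM, hornerX, hornerC, horner_comp); ring.
Qed.

Lemma iter_dual_poly k p :
  1 - iter k (horner f) p = iter k (horner (dual_poly f)) (1 - p).
Proof. by elim: k => //= k <-; rewrite horner_dual_poly subKr. Qed.

End DualPoly.

Lemma horner_dual_event_poly (R : realType) (E : finType) (A : {set {set E}}) (q : R) :
  (dual_poly (event_poly R A)).[q] = (event_poly R (dual_event A)).[q].
Proof.
rewrite horner_dual_poly !horner_event_poly -event_weight_dual.
by apply: eq_bigr => w _; apply: eq_bigr => e _; rewrite subKr.
Qed.

Lemma crossing_up (G : ograph) (w w' : {set edge G}) :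
  w \subset w' -> w \in crossing G -> w' \in crossing G.
Proof. by rewrite !inE; exact: linked_mono. Qed.

Section Seed.
Variables (R : realType) (G : ograph).
Hypotheses (G_connected : graph_connected G)
  (G_dist : (1 < gdist (lend G) (rend G))%N) (G_paths : two_edge_disjoint_paths G).

Notation D := (gdist (lend G) (rend G)).
Notation C := (mincut G).
Notation M := (2 ^+ #|edge G| : R).
Notation f := (event_poly R (crossing G)).
Notation g := (dual_poly f).

Lemma seed_lend_neq_rend : lend G != rend G.
Proof.
by apply: contraTneq G_dist => <-; rewrite -leqNgt (leq_trans (gdist_le (s := [::]) _))//=.
Qed.

Lemma crossing_poly_ge (p : R) : 0 <= p <= 1 -> p ^+ D <= f.[p].
Proof.
move=> p01; have [s path_s size_s] := linked_gdist_path (G_connected (lend G) (rend G)).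
have open_path (w : {set edge G}) : [set e in s] \subset w -> w \in crossing G.
  by move=> /subsetP sw; rewrite inE; apply: edge_path_linked path_s => e es; rewrite sw ?inE.
rewrite horner_event_poly; apply: le_trans (event_weight_ge p01 open_path).
case/andP: p01 => p0 p1; apply: ler_wiXn2l => //.
by rewrite cardsE (leq_trans (card_size _))// size_s.
Qed.

Lemma crossing_poly_le (p : R) : 0 <= p <= 1 -> f.[p] <= M * p ^+ D.
Proof.
move=> p01; rewrite horner_event_poly; apply: event_weight_le => // w.
by rewrite inE; exact: gdist_linked_card.
Qed.

Lemma dual_crossing_poly_ge (q : R) : 0 <= q <= 1 -> q ^+ C <= g.[q].
Proof.
move=> q01; have [[S cutS <-] _] := mincut_spec seed_lend_neq_rend.
rewrite horner_dual_event_poly horner_event_poly; apply: event_weight_ge => // w.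
by rewrite !inE -setCS => Sw; apply: contra cutS; exact: linked_mono.
Qed.

Lemma dual_crossing_poly_le (q : R) : 0 <= q <= 1 -> g.[q] <= M * q ^+ C.
Proof.
move=> q01; have [_ min_cut] := mincut_spec seed_lend_neq_rend.
rewrite horner_dual_event_poly horner_event_poly; apply: event_weight_le => // w.
by rewrite !inE => /min_cut.
Qed.

Lemma crossing_poly01 (p : R) : 0 < p < 1 -> 0 < f.[p] < 1.
Proof.
move=> /andP[p0 p1]; apply/andP; split.
  by apply: lt_le_trans (crossing_poly_ge _); rewrite ?exprn_gt0// !ltW.
have : 0 < g.[1 - p].
  by apply: lt_le_trans (dual_crossing_poly_ge _); rewrite ?exprn_gt0//; lra.
by rewrite horner_dual_poly subKr subr_gt0.
Qed.

(** Closing one edge of the full configuration leaves the ends linked because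
    cut-sets have at least two edges. *)
Lemma crossing_poly_sharp (p : R) : 0 < p < 1 ->
  f.[p] * (1 - f.[p]) < p * (1 - p) * f^`().[p].
Proof.
move=> p_in; have /andP[f0 f1] := crossing_poly01 p_in; have /andP[p0 p1] := p_in.
have p01 : 0 <= p <= 1 by rewrite !ltW.
have full : [set: edge G] \in crossing G by rewrite inE; exact: G_connected.
have cofull e : [set~ e] \in crossing G.
  have [_ min_cut] := mincut_spec seed_lend_neq_rend.
  rewrite inE; apply: contraLR (mincut_gt1 seed_lend_neq_rend G_paths) => cut_e.
  by rewrite -leqNgt -(cards1 e); exact: min_cut.
have := moore_shannon_strict (@crossing_up G) p01 full cofull
  (w := set0) (enum_uniq (edge G)).
rewrite cond_poly_enum => strict; apply: lt_le_trans (strict _); last first.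
  by apply/setP => e; rewrite !inE mem_enum.
by rewrite ltrDl mulr_gt0 ?exprn_gt0 ?subr_gt0.
Qed.

Lemma seed_constant_ge1 : 1 <= M.
Proof. by rewrite exprn_ege1// ler1n. Qed.

(** The bounds M p^D and M q^C, with exponents at least 2, put f below the
    diagonal near 0 and above it near 1. *)
Lemma crossing_poly_critical : exists ps : R,
  [/\ 0 < ps < 1, f.[ps] = ps, 1 < f^`().[ps],
    forall p : R, 0 < p < ps -> f.[p] < p & forall p : R, ps < p < 1 -> p < f.[p]].
Proof.
have M1 := seed_constant_ge1.
(* At this point M a^2 = a / 2, which leaves room for strictness. *)
pose a := (2 * M)^-1.
have [a0 aM] : 0 < a /\ M * a = 2^-1.
  have M0 : 0 < M by lra.
  by rewrite invr_gt0 mulr_gt0//; split => //; rewrite /a; field; rewrite gt_eqF.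
have a_le : a <= 2^-1 by rewrite -aM ler_peMl// ltW.
have small n : (1 < n)%N -> M * a ^+ n < a.
  move=> n2; apply: (@le_lt_trans _ _ (M * a ^+ 2)).
    by apply: ler_wpM2l; [lra|apply: ler_wiXn2l => //; lra].
  by rewrite expr2 mulrA aM; lra.
apply: (@sshaped_fixpoint _ _ crossing_poly01 crossing_poly_sharp a (1 - a)); [lra|lra| |].
  by apply: le_lt_trans (crossing_poly_le _) (small _ G_dist); lra.
suff : g.[a] < a by rewrite horner_dual_poly; lra.
apply: le_lt_trans (dual_crossing_poly_le _) (small _ _); first by lra.
exact: mincut_gt1 seed_lend_neq_rend G_paths.
Qed.

Variable ps : R.
Hypotheses (ps01 : 0 < ps < 1) (f_ps : f.[ps] = ps).

Lemma crossing_renorm_map : (forall p : R, 0 < p < ps -> f.[p] < p) ->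
  renorm_map f D M ps.
Proof.
split => //; [exact: seed_constant_ge1|exact: crossing_poly_ge|exact: crossing_poly_le|].
exact: sharp_homo crossing_poly01 crossing_poly_sharp.
Qed.

Lemma dual_crossing_renorm_map : (forall p : R, ps < p < 1 -> p < f.[p]) ->
  renorm_map g C M (1 - ps).
Proof.
move=> f_gt; split.
- exact: mincut_gt1 seed_lend_neq_rend G_paths.
- exact: seed_constant_ge1.
- by move: ps01 => ?; lra.
- by rewrite horner_dual_poly subKr f_ps.
- exact: dual_crossing_poly_ge.
- exact: dual_crossing_poly_le.
- move=> x y x0 xy y1; rewrite !horner_dual_poly lerB//.
  by apply: (sharp_homo crossing_poly01 crossing_poly_sharp); lra.
- by move=> q q_in; have := f_gt (1 - q); rewrite horner_dual_poly; lra.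
Qed.

End Seed.

(** * Crossing probabilities of the hierarchical graphs *)
Section HierarchicalGraph.
Variables (R : realType) (G1 : ograph).

Lemma crossing_prob0 (p : R) : crossing_prob G1 0 p = p.
Proof.
rewrite /crossing_prob /percolation_prob.
have -> : crossing (hier G1 0) = [set [set: unit]].
  apply/setP => w; rewrite !inE; apply/idP/eqP => [|->]; last first.
    by apply: (@linked_joins single_edge _ tt); rewrite ?inE.
  apply: contraTeq => wT; have w0 : w = set0.
    apply/setP => -[]; rewrite inE; apply/negbTE; apply: contra wT => tw.
    by apply/eqP/setP => -[]; rewrite tw inE.
  rewrite w0; apply/negP => linked0.
  have none (e : edge single_edge) : e \in set0 -> src e = tgt e by rewrite inE.
  by have := @linked_invariant single_edge _ id _ _ none linked0.
by rewrite big_set1 (big_pred1 tt) ?inE// => -[].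
Qed.

Hypothesis lend_neq_rend : lend G1 != rend G1.

(** In the graph of level k + 1, whose edges are those of level k replaced by
    copies of the seed, the copies are crossed independently with probability
    f(p). *)
Lemma crossing_prob_iter k (p : R) :
  crossing_prob G1 k p = iter k (horner (event_poly R (crossing G1))) p.
Proof.
elim: k p => [|k IH] p; first exact: crossing_prob0.
rewrite iterSr -IH horner_event_poly {IH}.
rewrite /crossing_prob /percolation_prob -!/(event_weight _ _) /=.
by rewrite crossing_replace// -event_weight_open_slices.
Qed.

End HierarchicalGraph.

Theorem theorem3p7 (R : realType) (G1 : ograph)
    (G1_connected : graph_connected G1)
    (G1_dist : (1 < gdist (lend G1) (rend G1))%N)
    (G1_paths : two_edge_disjoint_paths G1) :
  exists pstar : R,
    unique (crossing_fixpoint G1) pstar /\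
    let zeta : R := derive1 (@crossing_prob R G1 1) pstar in
    let nu : R := ln (gdist (lend G1) (rend G1))%:R / ln zeta in
    let mu : R := ln (mincut G1)%:R / ln zeta in
    [/\ 1 < zeta,
        (forall p : R, 0 < p < pstar -> cvgn (xi_seq G1 p) /\ 0 < xi G1 p) /\
        (forall p q : R, 0 < p -> p <= q -> q < pstar -> xi G1 p <= xi G1 q),
        (forall p : R, pstar < p < 1 -> cvgn (eta_seq G1 p) /\ 0 < eta G1 p) /\
        (forall p q : R, pstar < p -> p <= q -> q < 1 -> eta G1 q <= eta G1 p),
        (exists c1 c2 : R, [/\ 0 < c1, 0 < c2 &
          forall p : R, pstar / 2 < p < pstar ->
            c1 * (pstar - p) `^ (- nu) <= xi G1 p
              <= c2 * (pstar - p) `^ (- nu)]) &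
        (exists c3 c4 : R, [/\ 0 < c3, 0 < c4 &
          forall p : R, pstar < p < 1 - (1 - pstar) / 2 ->
            c3 * (p - pstar) `^ (- mu) <= eta G1 p
              <= c4 * (p - pstar) `^ (- mu)])].
Proof.
have ends := seed_lend_neq_rend G1_dist.
have [ps [ps01 f_ps df_ps f_lt f_gt]] := crossing_poly_critical R G1_connected G1_dist G1_paths.
have f_map := crossing_renorm_map G1_connected G1_dist G1_paths ps01 f_ps f_lt.
have g_map := dual_crossing_renorm_map G1_connected G1_dist G1_paths ps01 f_ps f_gt.
set f := event_poly R (crossing G1) in f_ps df_ps f_lt f_gt f_map g_map.
have [ps0 ps1] : 0 < ps /\ ps < 1 by case/andP: ps01.
have crossing_probE k : @crossing_prob R G1 k = iter k (horner f).
  by apply/funext => p; exact: crossing_prob_iter.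
have xi_seqE (p : R) : xi_seq G1 p = lograte f (gdist (lend G1) (rend G1)) p.
  by apply/funext => k; rewrite /xi_seq crossing_probE.
have eta_seqE (p : R) : eta_seq G1 p = lograte (dual_poly f) (mincut G1) (1 - p).
  by apply/funext => k; rewrite /eta_seq crossing_probE iter_dual_poly.
have xiE (p : R) : xi G1 p = corrlen f (gdist (lend G1) (rend G1)) p.
  by rewrite /xi xi_seqE.
have etaE (p : R) : eta G1 p = corrlen (dual_poly f) (mincut G1) (1 - p).
  by rewrite /eta eta_seqE.
exists ps; split.
  split; first by split => //; rewrite crossing_probE.
  move=> p [/andP[p0 p1]]; rewrite crossing_probE /= => fp.
  case: (ltgtP p ps) => // [p_lt|p_gt].
    by have := f_lt p; rewrite fp ltxx p0 p_lt => /(_ isT).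
  by have := f_gt p; rewrite fp ltxx p1 p_gt => /(_ isT).
move=> zeta nu mu.
have zetaE : zeta = f^`().[ps] by rewrite /zeta crossing_probE derivE.
have dgE : (dual_poly f)^`().[1 - ps] = zeta by rewrite deriv_dual_poly subKr.
split.
- by rewrite zetaE.
- split=> [p p_in|p q p0 pq q_lt]; last by rewrite !xiE; exact: (corrlen_homo f_map).
  by rewrite xi_seqE xiE; split; [exact: (lograte_cvg f_map)|exact: (corrlen_gt0 f_map)].
- split=> [p p_in|p q p_gt pq q1]; last first.
    by rewrite !etaE; apply: (corrlen_homo g_map); lra.
  rewrite eta_seqE etaE.
  by split; [apply: (lograte_cvg g_map)|apply: (corrlen_gt0 g_map)]; lra.
- have [//|c1 [c2 [c1_gt0 c2_gt0 bounds]]] := corrlen_power_law f_map.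
  by exists c1, c2; split => // p p_in; rewrite xiE /nu zetaE; exact: bounds.
have [|c3 [c4 [c3_gt0 c4_gt0 bounds]]] := corrlen_power_law g_map; first by rewrite dgE zetaE.
exists c3, c4; split => // p p_in; rewrite etaE /mu -dgE.
have -> : p - ps = 1 - ps - (1 - p) by ring.
by apply: bounds; lra.
Qed.
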